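(* Given a string $T$ of length $n$ and a string attractor $\Gamma$ of size $\gamma$ for $T$, one can build a collage system for $T$ of size $\mathcal{O}(\gamma\log(n/\gamma))$.
   Context: A string attractor of $T$ is a set $\Gamma\subseteq\{1,\dots,n\}$ such that every substring $T[i..j]$ has an occurrence $T[i'..j']=T[i..j]$ with $p\in[i',j']$ for some $p\in\Gamma$. A collage system is a finite acyclic set of rules, each defining a distinct nonterminal, of types $X\rightarrow a$ (terminal), $X\rightarrow AB$, $X\rightarrow R^{\ell}$ (repetition of $R$), and $X\rightarrow K[l..r]$ (substring of the expansion of $K$), with $A,B,R,K\ne X$; it generates the expansion of a starting nonterminal. Its size is the number of rules.
   Formalization: The bound is proved as O(γ·max(1, log₂(n/γ))) for nonempty T; the literal O(γ log(n/γ)) fails at γ = n, where the logarithm is 0 but a collage system needs at least one rule. *)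

(* Defs.v *)
From mathcomp Require Import all_boot all_order all_algebra.
From mathcomp Require Import reals exp.

Set Implicit Arguments.
Unset Strict Implicit.
Unset Printing Implicit Defensive.

(* Positions of a string are 0-based, and [substr s i j] is the factor
   s[i..j] with both ends included; it is meaningful for i <= j < size s. *)
Definition substr (Sigma : Type) (s : seq Sigma) (i j : nat) : seq Sigma :=
  take (j.+1 - i) (drop i s).

Definition string_attractor (Sigma : Type) (T : seq Sigma)
    (Gamma : {set 'I_(size T)}) : Prop :=
  forall i j : nat, i <= j < size T ->
  exists i' j' : nat,
    [/\ i' <= j' < size T,
        substr T i' j' = substr T i j
      & exists2 p : 'I_(size T), p \in Gamma & i' <= p <= j'].

(* X -> a, X -> A B, X -> R^l and X -> K[l..r] *)
Inductive rhs (Sigma V : Type) : Type :=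
| Terminal of Sigma
| Concat of V & V
| Repeat of V & nat
| Substring of V & nat & nat.

Definition rhs_nonterminals (Sigma V : Type) (e : rhs Sigma V) : seq V :=
  match e with
  | Terminal _ => [::]
  | Concat A B => [:: A; B]
  | Repeat R _ => [:: R]
  | Substring K _ _ => [:: K]
  end.

(* The rules form a function on the nonterminals: each nonterminal is defined
   by exactly one rule, so there are as many rules as nonterminals. *)
Record pre_collage (Sigma : Type) : Type := PreCollage {
  nonterminal : finType;
  rule : nonterminal -> rhs Sigma nonterminal;
  start : nonterminal
}.

Definition collage_size (Sigma : Type) (G : pre_collage Sigma) : nat :=
  #|nonterminal G|.

Inductive expands (Sigma : Type) (G : pre_collage Sigma) :
    nonterminal G -> seq Sigma -> Prop :=
| ExpandsTerminal X a :
    rule X = Terminal _ a -> expands X [:: a]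
| ExpandsConcat X A B u v :
    rule X = Concat _ A B -> expands A u -> expands B v -> expands X (u ++ v)
| ExpandsRepeat X R l u :
    rule X = Repeat _ R l -> expands R u -> expands X (flatten (nseq l u))
| ExpandsSubstring X K l r u :
    rule X = Substring _ K l r -> expands K u -> expands X (substr u l r).

Definition depends (Sigma : Type) (G : pre_collage Sigma) :
    rel (nonterminal G) :=
  fun X Y => Y \in rhs_nonterminals (rule X).

(* In particular no nonterminal occurs in its own rule. *)
Definition acyclic (Sigma : Type) (G : pre_collage Sigma) : Prop :=
  forall X Y : nonterminal G, depends X Y -> ~~ connect (@depends _ G) Y X.

Definition collage_system (Sigma : Type) (G : pre_collage Sigma) : Prop :=
  [/\ acyclic G,
      forall (X R : nonterminal G) (l : nat), rule X = Repeat _ R l -> 0 < l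
    & forall (X K : nonterminal G) (l r : nat) (u : seq Sigma),
        rule X = Substring _ K l r -> expands K u -> l <= r < size u].

Definition generates (Sigma : Type) (G : pre_collage Sigma) (T : seq Sigma) :
    Prop :=
  expands (start G) T.

Lemma expands_unique (Sigma : Type) (G : pre_collage Sigma)
    (X : nonterminal G) (u v : seq Sigma) :
  expands X u -> expands X v -> u = v.
Proof.
move=> Xu; elim: Xu v => {X u}.
- by move=> X a ruleX v Xv; case: Xv ruleX => {X v} [X b|X A B u v|X R l u|X K l r u] -> // [->].
- move=> X A B u1 u2 ruleX _ IHA _ IHB v Xv.
  case: Xv ruleX IHA IHB => {X v} [X b|X A' B' v1 v2|X R l v1|X K l r v1] -> //.
  by move=> Av Bv [<- <-] IHA IHB; rewrite (IHA _ Av) (IHB _ Bv).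
- move=> X R l u1 ruleX _ IHR v Xv.
  case: Xv ruleX IHR => {X v} [X b|X A' B' v1 v2|X R' l' v1|X K l' r v1] -> //.
  by move=> Rv [<- <-] IHR; rewrite (IHR _ Rv).
- move=> X K l r u1 ruleX _ IHK v Xv.
  case: Xv ruleX IHK => {X v} [X b|X A' B' v1 v2|X R' l' v1|X K' l' r' v1] -> //.
  by move=> Kv [<- <- <-] IHK; rewrite (IHK _ Kv).
Qed.

Lemma expands_exists (Sigma : Type) (G : pre_collage Sigma) :
  acyclic G -> forall X : nonterminal G, exists u, expands X u.
Proof.
move=> acG X.
have [n] := ubnP #|connect (@depends _ G) X|; elim: n X => // n IHn X ltXn.
have IH Y : depends X Y -> exists u, expands Y u.
  move=> XY; apply: IHn; rewrite -ltnS; apply: leq_trans ltXn; rewrite ltnS.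
  apply/proper_card/properP; split.
    by apply/subsetP=> Z; apply: connect_trans; apply: connect1.
  by exists X; [apply: connect0 | apply: acG].
case ruleX: (rule X) => [a|A B|R l|K l r]; rewrite /depends ruleX in IH.
- by exists [:: a]; apply: ExpandsTerminal.
- have [u Au] := IH A (mem_head _ _).
  have [|v Bv] := IH B; first by rewrite !inE eqxx orbT.
  by exists (u ++ v); apply: ExpandsConcat Au Bv.
- have [u Ru] := IH R (mem_head _ _).
  by exists (flatten (nseq l u)); apply: ExpandsRepeat Ru.
- have [u Ku] := IH K (mem_head _ _).
  by exists (substr u l r); apply: ExpandsSubstring Ku.
Qed.

Definition log2 (R : realType) (x : R) : R := (ln x / ln 2)%R.

(* Main.v *)
Require Import Defs.
From mathcomp Require Import all_boot all_order all_algebra.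
From mathcomp Require Import reals exp zify lra.

Set Implicit Arguments.
Unset Strict Implicit.
Unset Printing Implicit Defensive.

(** Around every attractor position [p] consider the balls of radius
    [2^i - 1], clipped to the string.  The ball of level [i.+1] is the ball of
    level [i] with two factors of length at most [2^i] attached; each of these
    has an occurrence crossing some attractor position [q], hence lies inside
    the ball of level [i] around [q] and costs one substring rule.  Thus a level
    costs four rules per attractor position.  Once [2^k] exceeds [n / gamma], the
    string is a concatenation of [gamma] blocks of length at most [2^k], each of
    which is again a substring of a ball of level [k]. *)

(** * Adding one rule to a collage system *)

Section ExtendCollage.

Variable Sigma : Type.

Definition map_rhs (V W : Type) (f : V -> W) (e : rhs Sigma V) : rhs Sigma W :=
  match e with
  | Terminal a => Terminal _ a
  | Concat A B => Concat _ (f A) (f B)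
  | Repeat R l => Repeat _ (f R) l
  | Substring K l r => Substring _ (f K) l r
  end.

Lemma rhs_nonterminals_map (V W : Type) (f : V -> W) (e : rhs Sigma V) :
  rhs_nonterminals (map_rhs f e) = map f (rhs_nonterminals e).
Proof. by case: e. Qed.

Variables (G : pre_collage Sigma) (e : rhs Sigma (nonterminal G)).

(** Since [e] ranges over old nonterminals only, no rule can mention [None], so the new start lies
    on no cycle. *)
Definition extend_collage : pre_collage Sigma :=
  @PreCollage Sigma (option (nonterminal G))
    (fun X => map_rhs Some (if X is Some x then rule x else e)) None.

Lemma collage_size_extend : collage_size extend_collage = (collage_size G).+1.
Proof. exact: card_option. Qed.

Lemma expands_extend (X : nonterminal G) (u : seq Sigma) :
  expands X u -> @expands _ extend_collage (Some X) u.
Proof.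
elim=> {X u} [X a eX|X A B u v eX _ IHA _ IHB|X S l u eX _ IHS|X K l r u eX _ IHK].
- by apply: ExpandsTerminal; rewrite /= eX.
- by apply: ExpandsConcat IHA IHB; rewrite /= eX.
- by apply: ExpandsRepeat IHS; rewrite /= eX.
- by apply: ExpandsSubstring IHK; rewrite /= eX.
Qed.

Lemma depends_extend (X Y : nonterminal extend_collage) :
  depends X Y -> exists2 y, Y = Some y & forall x, X = Some x -> depends x y.
Proof.
rewrite /depends /= rhs_nonterminals_map => /mapP[y yX ->].
by exists y => // x eX; rewrite eX in yX.
Qed.

Lemma connect_extend (x : nonterminal G) (Y : nonterminal extend_collage) :
  connect (@depends _ extend_collage) (Some x) Y ->
  exists2 y, Y = Some y & connect (@depends _ G) x y.
Proof.
move=> /connectP[p]; elim: p x => [|Z p IHp] x /=.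
  by move=> _ ->; exists x => //; apply: connect0.
move=> /andP[xZ pp] eY; have [z eZ /(_ _ erefl) xz] := depends_extend xZ.
rewrite eZ in pp eY; have [y -> zy] := IHp _ pp eY.
by exists y => //; apply: connect_trans zy; apply: connect1.
Qed.

Hypothesis collageG : collage_system G.

Lemma acyclic_extend : acyclic extend_collage.
Proof.
have [acG _ _] := collageG.
move=> X Y XY; have [y eY Hy] := depends_extend XY; rewrite eY.
apply/negP => /connect_extend[x eX yx].
by move/negP: (acG _ _ (Hy _ eX)).
Qed.

(** By acyclicity [X] has some expansion in [G]; it lifts to the extension, where uniqueness
    identifies it with [u]. *)
Lemma expands_extend_inv (X : nonterminal G) (u : seq Sigma) :
  @expands _ extend_collage (Some X) u -> expands X u.
Proof.
have [acG _ _] := collageG; have [v Xv] := expands_exists acG X.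
by move=> Xu; rewrite (expands_unique Xu (expands_extend Xv)).
Qed.

Lemma collage_system_extend :
  (forall S l, e = Repeat _ S l -> (0 < l)%N) ->
  (forall K l r u, e = Substring _ K l r -> expands K u -> (l <= r < size u)%N) ->
  collage_system extend_collage.
Proof.
have [_ repG subG] := collageG => repe sube.
split; first exact: acyclic_extend.
- move=> X S l /= eX.
  suff [S' eS] : exists S', (if X is Some x then rule x else e) = Repeat _ S' l.
    by case: X eS {eX} => [x|]; [apply: repG | apply: repe].
  by case: (if X is Some x then rule x else e) eX => //= S' ? [_ <-]; exists S'.
- move=> X K l r u /= eX Ku.
  have [K' eK' eS] : exists2 K', K = Some K' &
      (if X is Some x then rule x else e) = Substring _ K' l r.
    by case: (if X is Some x then rule x else e) eX => //= K' ? ? [<- <- <-]; exists K'.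
  rewrite eK' in Ku; move/expands_extend_inv: Ku => Ku.
  by case: X eS {eX} => [x|] eS; [apply: subG eS Ku | apply: sube eS Ku].
Qed.

End ExtendCollage.

(** * Collage systems as lists of strings, each derived from those after it *)

Section StraightLine.

Variable Sigma : eqType.
Implicit Types (u v w : seq Sigma) (s t : seq (seq Sigma)).

(** Strings of [s] stand for the nonterminals expanding to them. Nonemptiness in [DerivInfix]
    matches the bound [l <= r < size u] on substring rules. *)
Variant derivable_from s : seq Sigma -> Prop :=
| DerivTerminal a : derivable_from s [:: a]
| DerivConcat u v : u \in s -> v \in s -> derivable_from s (u ++ v)
| DerivInfix u v : u \in s -> v != [::] -> infix v u -> derivable_from s v.

Fixpoint straight_line s : Prop :=
  if s is w :: s' then derivable_from s' w /\ straight_line s' else True.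

Lemma straight_line_catr s t : straight_line (s ++ t) -> straight_line t.
Proof. by elim: s => //= w s IHs [_ /IHs]. Qed.

Lemma infix_substr u v : v != [::] -> infix v u ->
  exists l r, (l <= r < size u)%N /\ substr u l r = v.
Proof.
move=> v0 /infixP[x [y ->]]; have {v0} : (0 < size v)%N by case: v v0.
move=> v0; exists (size x), (size x + size v).-1; rewrite !size_cat; split.
  by lia.
rewrite /substr drop_size_cat // take_size_cat //; lia.
Qed.

(** Each string of the list becomes one rule, added from the tail on. The last clause strengthens
    the induction: the next rule may refer to any earlier string. *)
Lemma straight_line_collage w s : straight_line (w :: s) ->
  exists G : pre_collage Sigma,
    [/\ collage_system G, generates G w, collage_size G = (size s).+1
      & forall u, u \in w :: s -> exists X : nonterminal G, expands X u].
Proof.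
elim: s w => [|w' s IHs] w.
  (* Over an empty list only a terminal is derivable. *)
  move=> [[a|u v //|u v //] _].
  pose G := @PreCollage Sigma unit (fun _ => Terminal _ a) tt.
  have Ga (X : nonterminal G) : expands X [:: a] by apply: ExpandsTerminal.
  exists G; split=> //.
  - exact: card_unit.
  - by move=> u; rewrite inE => /eqP->; exists tt.
move=> [w_der /IHs[G [colG _ sizeG Gs]]].
suff [e [repe sube ew]] : exists e : rhs Sigma (nonterminal G),
    [/\ forall S l, e = Repeat _ S l -> (0 < l)%N,
        forall K l r u, e = Substring _ K l r -> expands K u ->
          (l <= r < size u)%N
      & @expands _ (extend_collage e) None w].
  exists (extend_collage e); split=> //.
  - exact: collage_system_extend.
  - by rewrite collage_size_extend sizeG.
  - move=> u; rewrite inE => /predU1P[-> | /Gs[X Xu]]; first by exists None.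
    by exists (Some X); apply: expands_extend.
case: w_der => [a|u v /Gs[A Au] /Gs[B Bv]|u v /Gs[K Ku] v0 vu].
- by exists (Terminal _ a); split=> //; apply: ExpandsTerminal.
- exists (Concat _ A B); split=> //.
  by apply: ExpandsConcat; [reflexivity | apply: expands_extend..].
- have [l [r [lr <-]]] := infix_substr v0 vu.
  exists (Substring _ K l r); split=> //.
    by move=> _ _ _ x [<- <- <-] Kx; rewrite (expands_unique Kx Ku).
  by apply: ExpandsSubstring; [reflexivity | apply: expands_extend].
Qed.

(* The empty string counts as available: it has no collage system, but clipped
   factors may be empty. *)
Definition available s w := (w == [::]) || (w \in s).

Lemma available_sub s t w : {subset s <= t} -> available s w -> available t w.
Proof. by move=> st /orP[/eqP->|/st wt]; rewrite /available ?eqxx ?wt ?orbT. Qed.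

Definition grows (c : nat) s t :=
  [/\ straight_line t, {subset s <= t} & (size t <= size s + c)%N].

Lemma grows_refl s : straight_line s -> grows 0 s s.
Proof. by split=> //; rewrite addn0. Qed.

Lemma grows_trans c d s t r : grows c s t -> grows d t r -> grows (c + d) s r.
Proof.
move=> [_ st szt] [slr tr szr]; split=> //; first by move=> x /st /tr.
by lia.
Qed.

Lemma grows_available c s t w : grows c s t -> available s w -> available t w.
Proof. by case=> _ st _; apply: available_sub. Qed.

Lemma grows_derivable s w : straight_line s -> derivable_from s w ->
  exists2 t, grows 1 s t & available t w.
Proof.
move=> sls sw; exists (w :: s); last by rewrite /available inE eqxx orbT.
by split=> //= [x xs|]; [rewrite inE xs orbT | rewrite addn1].
Qed.

(** Charging one rule even when none is added gives degenerate empty cases the same cost as the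
    others. *)
Lemma grows_skip s w : straight_line s -> available s w ->
  exists2 t, grows 1 s t & available t w.
Proof. by move=> sls sw; exists s => //; split=> //; lia. Qed.

Lemma grows_concat s u v : straight_line s -> available s u -> available s v ->
  exists2 t, grows 1 s t & available t (u ++ v).
Proof.
move=> sls; case: (eqVneq u [::]) => [-> _|u0]; first exact: grows_skip.
case: (eqVneq v [::]) => [-> su _|v0]; first by rewrite cats0; apply: grows_skip.
rewrite /available (negPf u0) (negPf v0) /= => su sv.
by apply: grows_derivable => //; apply: DerivConcat.
Qed.

Lemma grows_infix s u v : straight_line s -> available s u -> infix v u ->
  exists2 t, grows 1 s t & available t v.
Proof.
move=> sls; case: (eqVneq v [::]) => [-> _ _|v0]; first exact: grows_skip.
case: (eqVneq u [::]) => [->|u0]; first by rewrite infixs0 (negPf v0).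
rewrite /available (negPf u0) /= => su vu.
by apply: grows_derivable => //; apply: (@DerivInfix _ u).
Qed.

(** The hypothesis ranges over all extensions [t] of [s] because the items handled earlier have
    already enlarged the list. *)
Lemma grows_all (I : eqType) (f : I -> seq Sigma) c (ps : seq I) s :
    straight_line s ->
    (forall p t, p \in ps -> straight_line t -> {subset s <= t} ->
       exists2 r, grows c t r & available r (f p)) ->
  exists2 r, grows (c * size ps) s r & forall p, p \in ps -> available r (f p).
Proof.
move=> sls; elim: ps => [|p ps IHps] grow.
  by exists s => //; rewrite muln0; apply: grows_refl.
have [|t gt ft] := IHps.
  by move=> q t qps; apply: grow; rewrite inE qps orbT.
have [slt st _] := gt; have [r gr fr] := grow p t (mem_head _ _) slt st.
exists r => [|q]; first by rewrite mulnSr; apply: grows_trans gt gr.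
by rewrite inE => /predU1P[->//|/ft]; apply: grows_available gr.
Qed.

End StraightLine.

(** * Balls around attractor positions *)

Section Attractor.

Variables (Sigma : eqType) (T : seq Sigma).

(* Half-open and clipped to the string; [substr T i j] is [factor i j.+1]. *)
Definition factor (a b : nat) : seq Sigma := take (b - a) (drop a T).

Lemma size_factor a b : size (factor a b) = (minn b (size T) - a)%N.
Proof. rewrite size_take_min size_drop; lia. Qed.

Lemma factor_clip a b : factor a b = factor a (minn b (size T)).
Proof.
case: (leqP b (size T)) => [//|Tb].
by rewrite /factor !take_oversize ?size_drop //; lia.
Qed.

Lemma factor_cat a b c : (a <= b <= c)%N -> factor a c = factor a b ++ factor b c.
Proof.
move=> abc; rewrite /factor (_ : (c - a = (b - a) + (c - b))%N); last by lia.
by rewrite takeD drop_drop subnK //; lia.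
Qed.

Lemma infix_factor a b c d : (c <= a <= b)%N -> (b <= d)%N ->
  infix (factor a b) (factor c d).
Proof.
move=> cab bd; apply/infixP; exists (factor c a), (factor b d).
rewrite -factor_cat; last by lia.
by rewrite -factor_cat //; lia.
Qed.

(* Radius [2 ^ i - 1]; truncated subtraction clips it on the left. *)
Definition ball (i p : nat) : seq Sigma := factor (p.+1 - 2 ^ i) (p + 2 ^ i).

Lemma ball0 (p : 'I_(size T)) : exists a, ball 0 p = [:: a].
Proof.
have : size (ball 0 p) = 1%N by rewrite size_factor; have := ltn_ord p; lia.
by case: (ball 0 p) => [|a [|b l]] //; exists a.
Qed.

Lemma ballS i p :
  ball i.+1 p = factor (p.+1 - 2 ^ i.+1) (p.+1 - 2 ^ i) ++ ball i p
                ++ factor (p + 2 ^ i) (p + 2 ^ i.+1).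
Proof.
have := expn_gt0 2 i; rewrite /ball expnS => ?.
rewrite -factor_cat; last by lia.
by rewrite -factor_cat //; lia.
Qed.

Variable Gamma : {set 'I_(size T)}.
Hypothesis attractor : string_attractor Gamma.

Lemma attractor_gt0 : (0 < size T)%N -> (0 < #|Gamma|)%N.
Proof.
move=> T0; have [|i [j [_ _ [p pG _]]]] := @attractor 0 0; first by [].
by apply/card_gt0P; exists p.
Qed.

(** An occurrence of length at most [2 ^ i] that contains [q] extends at most [2 ^ i - 1] positions
    to either side of it. *)
Lemma short_factor_in_ball i a b : (b - a <= 2 ^ i)%N -> factor a b != [::] ->
  exists2 q, q \in Gamma & infix (factor a b) (ball i q).
Proof.
(* Clipping makes [b' - a] the exact length; [b'.-1] is then the inclusive right end that the
   attractor property expects. *)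
rewrite factor_clip -size_eq0 size_factor; set b' := minn b _ => sab nz.
have [|i' [j' [ij' sub_eq [q qG qij]]]] := @attractor a b'.-1; first by lia.
exists q => //; move: sub_eq; rewrite -![substr _ _ _]/(factor _ _.+1).
rewrite prednK; last by lia.
move=> sub_eq; have := congr1 size sub_eq; rewrite !size_factor => sizes.
by rewrite -sub_eq; apply: infix_factor; lia.
Qed.

Lemma grows_short_factor i s a b : straight_line s ->
    {in Gamma, forall q : 'I_(size T), available s (ball i q)} ->
    (b - a <= 2 ^ i)%N ->
  exists2 t, grows 1 s t & available t (factor a b).
Proof.
move=> sls balls sab; case: (eqVneq (factor a b) [::]) => [->|nz].
  exact: grows_skip.
have [q /balls sq qab] := short_factor_in_ball sab nz.
exact: grows_infix sq qab.
Qed.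

Lemma grows_ballS i s (p : 'I_(size T)) : straight_line s ->
    {in Gamma, forall q : 'I_(size T), available s (ball i q)} -> p \in Gamma ->
  exists2 t, grows 4 s t & available t (ball i.+1 p).
Proof.
move=> sls balls pG; rewrite ballS.
set l := factor _ (_ - _); set r := factor (_ + _) _.
(* One rule for each flank, then two concatenations. *)
have [|t1 g1 lt1] := @grows_short_factor i s (p.+1 - 2 ^ i.+1) (p.+1 - 2 ^ i) sls balls.
  by rewrite expnS; lia.
have [sl1 _ _] := g1.
have [q qG||t2 g2 rt2] := @grows_short_factor i t1 (p + 2 ^ i) (p + 2 ^ i.+1) sl1.
- exact: grows_available g1 (balls q qG).
- by rewrite expnS; lia.
have [sl2 _ _] := g2.
have bt2 := grows_available g2 (grows_available g1 (balls p pG)).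
have [t3 g3 brt3] := grows_concat sl2 bt2 rt2.
have [sl3 _ _] := g3.
have lt3 := grows_available g3 (grows_available g2 lt1).
have [t4 g4 lbrt4] := grows_concat sl3 lt3 brt3.
by exists t4 => //; exact: grows_trans (grows_trans (grows_trans g1 g2) g3) g4.
Qed.

(** Each position pays one terminal rule at level 0 and four rules per further level. *)
Lemma grows_balls i :
  exists2 t, grows (#|Gamma| * (4 * i).+1) [::] t &
    {in Gamma, forall q : 'I_(size T), available t (ball i q)}.
Proof.
elim: i => [|i [t gt balls]].
  have [||t gt Ht] := @grows_all _ _ (fun p : 'I_(size T) => ball 0 p) 1 (enum Gamma) [::].
  - by [].
  - move=> p t _ slt _; have [a ->] := ball0 p.
    by apply: grows_derivable => //; apply: DerivTerminal.
  exists t; first by rewrite cardE muln1 -[X in grows X _ _]mul1n.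
  by move=> q qG; apply: Ht; rewrite mem_enum.
have [slt _ _] := gt.
have [|r gr Hr] :=
    @grows_all _ _ (fun p : 'I_(size T) => ball i.+1 p) 4 (enum Gamma) t slt.
  move=> p r; rewrite mem_enum => pG slr tr; apply: grows_ballS => // q /balls.
  exact: available_sub.
exists r; last by move=> q qG; apply: Hr; rewrite mem_enum.
have := grows_trans gt gr; rewrite -cardE [(4 * #|_|)%N]mulnC -mulnDr.
by rewrite addSn -mulnSr.
Qed.

(** Each block costs one substring rule and one concatenation; blocks beyond the end of [T] are
    clipped, possibly to the empty string. *)
Lemma grows_prefix i s m : straight_line s ->
    {in Gamma, forall q : 'I_(size T), available s (ball i q)} ->
  exists2 t, grows (2 * m) s t & available t (factor 0 (m * 2 ^ i)).
Proof.
move=> sls balls; elim: m => [|m [t gt mt]].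
  by exists s; [apply: grows_refl | rewrite mul0n /factor take0].
have [slt _ _] := gt.
have [q /balls||t1 g1 bt1] :=
    @grows_short_factor i t (m * 2 ^ i) (m.+1 * 2 ^ i) slt.
- exact: grows_available gt.
- by rewrite mulSn; lia.
have [sl1 _ _] := g1.
have [t2 g2 ct2] := grows_concat sl1 (grows_available g1 mt) bt1.
exists t2; last by rewrite (@factor_cat _ (m * 2 ^ i)) // mulSn; lia.
have := grows_trans (grows_trans gt g1) g2.
by congr (grows _ _ _); lia.
Qed.

Lemma attractor_collage k : (0 < size T <= #|Gamma| * 2 ^ k)%N ->
  exists G : pre_collage Sigma,
    [/\ collage_system G, generates G T
      & (collage_size G <= #|Gamma| * (4 * k + 3))%N].
Proof.
move=> /andP[T0 Tk]; have [s gs balls] := grows_balls k; have [sls _ _] := gs.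
have [t gt] := grows_prefix #|Gamma| sls balls.
have -> : factor 0 (#|Gamma| * 2 ^ k) = T.
  by rewrite /factor subn0 drop0 take_oversize.
have -> : available t T = (T \in t) by rewrite /available; case: (T) T0.
have [slt _ szt] := grows_trans gs gt.
(* The start must expand to [T], so the strings added after [T] are dropped; the remaining tail is
   still straight-line. *)
move=> Tt; case/splitPr: t / Tt slt szt {gt} => t1 t2 slt szt.
have [G [colG genG szG _]] := straight_line_collage (straight_line_catr slt).
exists G; split=> //; move: szt; rewrite szG size_cat /=; lia.
Qed.

End Attractor.

(** * From the level count to the logarithmic bound *)

Local Open Scope ring_scope.
Import Order.TTheory GRing.Theory Num.Theory.

(** With [k] the truncated logarithm, [2 ^ k * g <= n]; take logarithms. *)
Lemma trunc_log_le_log2 (R : realType) (n g : nat) : (0 < g <= n)%N ->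
  (trunc_log 2 (n %/ g))%:R <= log2 (n%:R / g%:R : R).
Proof.
move=> /andP[g0 gn]; rewrite /log2.
have ln2 : 0 < ln (2 : R) by rewrite ln_gt0 // ltr1n.
have gR : 0 < g%:R :> R by rewrite ltr0n.
rewrite ler_pdivlMr // [leLHS]mulr_natl -lnXn ?ltr0n // ler_ln ?posrE ?exprn_gt0 //.
  rewrite ler_pdivlMr // -natrX -natrM ler_nat.
  apply: leq_trans (leq_trunc_div n g); rewrite leq_mul2r trunc_logP ?orbT //.
  by rewrite divn_gt0.
by rewrite divr_gt0 // ltr0n (leq_trans g0).
Qed.

Theorem theorem3p13 (R : realType) :
  exists C : R,
  forall (Sigma : eqType) (T : seq Sigma) (Gamma : {set 'I_(size T)}),
    (0 < size T)%N ->
    string_attractor Gamma ->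
    exists G : pre_collage Sigma,
      [/\ collage_system G,
          generates G T
        & (collage_size G)%:R <=
            C * (#|Gamma|%:R
                 * Num.max 1 (log2 ((size T)%:R / #|Gamma|%:R)))].
Proof.
(* Level [k.+1] costs [4 * k.+1 + 3 = 4 * k + 7] rules per position, and [k <= M], [1 <= M] bound
   this by [11 * M]. *)
exists 11 => Sigma T Gamma T0 attr.
have g0 := attractor_gt0 attr T0.
have gn : (#|Gamma| <= size T)%N by rewrite -[X in (_ <= X)%N]card_ord max_card.
set k := trunc_log 2 (size T %/ #|Gamma|).
have [|G [colG genG szG]] := attractor_collage attr (k := k.+1).
  (* Level [k.+1] suffices since the quotient [size T %/ #|Gamma|] is below [2 ^ k.+1]. *)
  by rewrite T0 mulnC ltnW // -ltn_divLR // trunc_log_ltn.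
exists G; split=> //; set M := Num.max _ _.
have kM : k%:R <= M by rewrite le_max trunc_log_le_log2 ?g0 ?orbT.
have M1 : 1 <= M by rewrite le_max lexx.
apply: (@le_trans _ _ (#|Gamma| * (4 * k + 7))%:R); first by rewrite ler_nat; lia.
rewrite natrM mulrCA ler_wpM2l // natrD natrM.
lra.
Qed.
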